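(* Let $X\subseteq 2^\omega$. The following are equivalent: (1) $X$ is perfectly meager. (2) For every countable dense-in-itself set $A\subseteq 2^\omega$ there exists a set $B\subseteq A$ such that $\operatorname{cl}(A)=\operatorname{cl}(B)$ and $B$ is a $G_\delta$-set relative to $X\cup A$. (3) For every countable set $A\subseteq 2^\omega$ there exists a set $B\subseteq A$ such that $\operatorname{cl}(A)=\operatorname{cl}(B)$ and $B$ is a $G_\delta$-set relative to $X\cup A$. (4) For every perfect set $P\subseteq 2^\omega$ there exists an $F_\sigma$ set $F\subseteq 2^\omega$ such that $X\subseteq F$ and $F$ is meager in $P$.
   Context: A set $X\subseteq 2^\omega$ is perfectly meager if for every perfect set $P\subseteq 2^\omega$, $P\cap X$ is meager in $P$ (with the subspace topology). $\operatorname{cl}$ denotes closure in $2^\omega$. A set is dense-in-itself if it has no isolated points in its subspace topology. ''$F$ is meager in $P$'' means that $F\cap P$ is a meager subset of the space $P$. ''$B$ is a $G_\delta$-set relative to $Z$'' means that $B$ is a $G_\delta$ subset of $Z$ in the subspace topology of $Z\subseteq 2^\omega$. *)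

(* Defs.v *)
From HB Require Import structures.
From mathcomp Require Import all_boot.
From mathcomp Require Import boolp classical_sets functions cardinality.
From mathcomp Require Import topology cantor borel_hierarchy.

Set Implicit Arguments.
Unset Strict Implicit.
Unset Printing Implicit Defensive.

Local Open Scope classical_set_scope.

Definition nowhere_dense {T : topologicalType} (S : set T) : Prop :=
  interior (closure S) = set0.

Definition meager {T : topologicalType} (S : set T) : Prop :=
  exists2 N : nat -> set T, (forall i, nowhere_dense (N i)) & S = \bigcup_i N i.

(* [subspace Z] has all points of the ambient type: Z is clopen in it and
   carries its subspace topology, while the points outside Z are isolated.
   Hence, for subsets of Z, being meager or G-delta in [subspace Z] is the same
   as being meager or G-delta in the space Z; the two relative notions below
   therefore only consider subsets of Z. *)
Definition meager_in {T : topologicalType} (P S : set T) : Prop :=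
  meager (S `&` P : set (subspace P)).

Definition Gdelta_in {T : topologicalType} (Z B : set T) : Prop :=
  B `<=` Z /\ Gdelta (B : set (subspace Z)).

Definition dense_in_itself {T : topologicalType} (A : set T) : Prop :=
  isolated A = set0.

(* The empty set counts as perfect ([perfect_set]: closed without isolated
   points); every set is trivially meager in it. *)
Definition perfectly_meager (X : set cantor_space) : Prop :=
  forall P : set cantor_space, perfect_set P -> meager_in P X.

(* Main.v *)
From HB Require Import structures.
Require Import Defs.
From mathcomp Require Import all_boot.
From mathcomp Require Import boolp classical_sets functions cardinality.
From mathcomp Require Import topology cantor borel_hierarchy.
From mathcomp Require Import reals Rstruct.

(* For (1) => (2), cover X on P = cl A by closed sets C_0, C_1, ... nowhere dense
   in P, and pick in the k-th basic open set meeting A a point of A outside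
   C_0, ..., C_(k-1).  These points form a set B dense in A that meets each C_i
   in a finite set, so each C_i \ B is F-sigma and B is G-delta in X U A.
   For (2) => (3), apply (2) to the largest dense-in-itself subset of A and add
   the isolated points of A, which form a G-delta set.
   For (3) => (4), apply (3) to a countable dense subset A of P: if G is a
   G-delta set with G n (X U A) = B, then the complement of G together with A
   is an F-sigma set covering X and meager in P. *)

Local Open Scope classical_set_scope.

(** * Isolated points under closure and open restriction *)

Lemma isolated_sandwich {T : topologicalType} (A E : set T) :
  A `<=` E -> E `<=` closure A -> isolated E `<=` isolated A.
Proof.
move=> AE EA x [/set_mem Ex [V nV VE]].
have [y [Ay Vy]] := EA x Ex V nV.
have yx : y = x by have : (V `&` E) y by [split=> //; exact: AE]; rewrite VE.
rewrite {y}yx in Ay Vy; split; first exact/mem_set.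
exists V => //; apply/seteqP; split=> [z [Vz Az]|_ ->//].
by rewrite -VE; split=> //; exact: AE.
Qed.

Lemma closure_dense_in_itself {T : topologicalType} (A : set T) :
  dense_in_itself A -> perfect_set (closure A).
Proof.
move=> iA; apply/perfectP; split; first exact: closed_closure.
rewrite -subset0 -iA.
by apply: isolated_sandwich => //; exact: subset_closure.
Qed.

Lemma isolated_setI {T : topologicalType} (O A : set T) :
  open O -> isolated (O `&` A) `<=` O `&` isolated A.
Proof.
move=> oO x [/set_mem[Ox Ax] [V nV VOA]]; split=> //; split; first exact/mem_set.
exists (V `&` O); last by rewrite -setIA.
by apply: filterI => //; exact: open_nbhs_nbhs.
Qed.

(** * Calculus of F-sigma and G-delta sets *)

Lemma Fsigma_bigcup {T : topologicalType} {I : Type} (D : set I)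
    (F : I -> set T) :
  countable D -> (forall i, D i -> Fsigma (F i)) -> Fsigma (\bigcup_(i in D) F i).
Proof.
move=> /pfcard_geP[-> _|[h] FF].
  by rewrite bigcup_set0; apply: closed_Fsigma; exact: closed0.
have /choice[g gP] : forall i, exists g : nat -> set T,
    D i -> (forall j, closed (g j)) /\ F i = \bigcup_j g j.
  move=> i; have [/FF[g gc ->]|nDi] := pselect (D i); first by exists g.
  by exists (fun=> set0).
(* Pairs [(m, j)] are coded by single numbers; a number that codes no pair contributes the empty
   set. *)
pose H n := if unpickle n is Some (m, j) then g (h m) j else set0.
have Dh m : D (h m) by exact: (@funS _ _ _ _ h m).
exists H => [n|].
  rewrite /H; case: unpickle => [[m j]|]; last exact: closed0.
  by have [gc _] := gP _ (Dh m).
apply/seteqP; split=> [x [i Di]|x [n _]].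
  have [_ ->] := gP _ Di; move=> [j _ gx].
  have [m _ hm] := @surj _ _ _ _ h i Di.
  by exists (pickle (m, j)) => //; rewrite /H pickleK hm.
rewrite /H; case: unpickle => [[m j]|//] gx; exists (h m) => //.
by have [_ ->] := gP _ (Dh m); exists j.
Qed.

Lemma FsigmaU {T : topologicalType} (A B : set T) :
  Fsigma A -> Fsigma B -> Fsigma (A `|` B).
Proof.
move=> FA FB; rewrite -bigcup2E; apply: Fsigma_bigcup => // -[|[|n]] _ //=.
by apply: closed_Fsigma; exact: closed0.
Qed.

Lemma FsigmaI {T : topologicalType} (A B : set T) :
  Fsigma A -> Fsigma B -> Fsigma (A `&` B).
Proof.
move=> [F cF ->] [G cG ->]; rewrite setI_bigcupl.
apply: Fsigma_bigcup => // i _; rewrite setI_bigcupr.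
by exists (fun j => F i `&` G j) => // j; exact: closedI.
Qed.

Lemma GdeltaC {T : topologicalType} (A : set T) : Gdelta (~` A) <-> Fsigma A.
Proof.
split=> [[F oF AF]|[F cF ->]].
  exists (fun i => ~` F i) => [i|]; first by rewrite closedC.
  by rewrite -setC_bigcap -AF setCK.
by exists (fun i => ~` F i) => [i|]; [rewrite openC|rewrite setC_bigcup].
Qed.

Lemma GdeltaU {T : topologicalType} (A B : set T) :
  Gdelta A -> Gdelta B -> Gdelta (A `|` B).
Proof.
by rewrite -[A]setCK -[B]setCK -setCI !GdeltaC; exact: FsigmaI.
Qed.

Lemma GdeltaI {T : topologicalType} (A B : set T) :
  Gdelta A -> Gdelta B -> Gdelta (A `&` B).
Proof.
by rewrite -[A]setCK -[B]setCK -setCU !GdeltaC; exact: FsigmaU.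
Qed.

Lemma countable_Fsigma {T : topologicalType} (A : set T) :
  accessible_space T -> countable A -> Fsigma A.
Proof.
move=> T1 cA; rewrite -[A]image_id -bigcup_imset1.
by apply: Fsigma_bigcup => // x _; exact/closed_Fsigma/accessible_closed_set1.
Qed.

Lemma open_Fsigma {T : topologicalType} (U : nat -> set T) (O : set T) :
  (forall k, closed (U k)) ->
  (forall x V, nbhs x V -> exists2 k, U k x & U k `<=` V) ->
  open O -> Fsigma O.
Proof.
move=> cU Ub oO.
suff -> : O = \bigcup_(k in [set k | U k `<=` O]) U k.
  by apply: Fsigma_bigcup => // k _; exact: closed_Fsigma.
apply/seteqP; split=> [x Ox|x [k]]; last exact.
have [k Ukx UO] := Ub x O (open_nbhs_nbhs (conj oO Ox)).
by exists k.
Qed.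

(** * Relative notions expressed by sets of the ambient space *)

Lemma Gdelta_inP {T : topologicalType} (Z B : set T) :
  Gdelta_in Z B <-> exists2 G, Gdelta G & B = G `&` Z.
Proof.
split=> [[BZ [F oF BF]]|[G [F oF ->] ->]].
  have /choice[V VP] : forall i, exists V, open (V : set T) /\ V `&` Z = F i `&` Z.
    by move=> i; have /open_subspaceP[V oV VF] := oF i; exists V.
  exists (\bigcap_i V i).
    by exists V => // i; have [] := VP i.
  rewrite -(setIidl BZ) BF; apply/seteqP; split=> x [Fx Zx]; split=> // i _.
    have [_ VF] := VP i.
    by have : (F i `&` Z) x by [split=> //; exact: Fx]; rewrite -VF => -[].
  have [_ VF] := VP i.
  by have : (V i `&` Z) x by [split=> //; exact: Fx]; rewrite VF => -[].
split; first exact: subIsetr.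
exists (fun i => F i `&` Z).
  by move=> i; rewrite open_subspaceIT; exact: open_subspaceW.
by rewrite bigcapIl.
Qed.

(** Nowhere dense pieces are replaced by their ambient closures, whose complements are dense in [P];
    conversely each [C i] is cut down to [S] and [P]. Asking only for a cover makes the condition
    visibly monotone in [S]. *)
Lemma meager_inP {T : topologicalType} (P S : set T) : closed P ->
  meager_in P S <->
  exists C : nat -> set T,
    [/\ forall i, closed (C i), forall i, P `<=` closure (P `\` C i)
      & S `&` P `<=` \bigcup_i C i].
Proof.
move=> cP; split=> [[N nN SN]|[C [cC dC SC]]].
  have NP i : N i `<=` P.
    by apply: subset_trans (@subIsetr _ S P); rewrite SN; exact: bigcup_sup.
  exists (fun i => closure (N i : set T)); split=> [i|i x Px V nV|].
  - exact: closed_closure.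
  - apply: contrapT => nPV.
    suff : interior (closure (N i : set (subspace P))) (x : subspace P).
      by rewrite nN.
    rewrite /interior /= closure_subspaceW//.
    (* By [nPV], the closure of [N i] contains the trace of [V] on [P]; adding it to [V] gives a
       neighbourhood with exactly the required trace. *)
    apply/(nbhs_subspace_ex _ Px); exists (V `|` closure (N i : set T)).
      by apply: filterS nV; exact: subsetUl.
    apply/seteqP; split=> [y [[Ny Py] _]|y [[Vy|Ny] Py]]; split=> //.
    - by right.
    - by split=> //; apply: contrapT => nNy; apply: nPV; exists y.
  - rewrite SN => x [i _ Nx]; exists i; [by []|exact: subset_closure].
exists (fun i => C i `&` (S `&` P)); last first.
  by rewrite -setI_bigcupl [RHS]setIidr.
move=> i; rewrite /nowhere_dense -subset0 => x; rewrite /interior /=.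
rewrite closure_subspaceW; last by move=> y [_ []].
move=> nx; have [_ Px] := nbhs_singleton nx.
move: nx => /(nbhs_subspace_ex _ Px)[V nV VC].
have [y [[Py nCy] Vy]] := dC i x Px _ nV; apply: nCy.
have : (V `&` P) y by [].
rewrite -VC => -[[cCy _] _]; apply: cC.
by apply: closureS cCy; exact: subIsetl.
Qed.

(** * Sets with dense complement in P, and the choice of dense sequences *)

Lemma closure_codenseU {T : topologicalType} (P C D : set T) :
  closed C -> P `<=` closure (P `\` C) -> P `<=` closure (P `\` D) ->
  P `<=` closure (P `\` (C `|` D)).
Proof.
move=> cC dC dD x Px V nV.
have nV' : nbhs x V° by exact: nbhs_interior.
have [y [[Py nCy] Vy]] := dC x Px _ nV'.
(* Since [C] is closed, removing it from the interior of [V] leaves an open neighbourhood of [y],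
   which the dense set [P] minus [D] must meet. *)
have [z [[Pz nDz] [Vz nCz]]] : (P `\` D) `&` (V° `&` ~` C) !=set0.
  apply: dD Py _ _; apply: open_nbhs_nbhs; split=> //.
  by apply: openI; [exact: open_interior|rewrite openC].
exists z; split; last exact: interior_subset.
by split=> // -[].
Qed.

Lemma closed_bigsetU_codense {T : topologicalType} (P : set T)
    (C : nat -> set T) (n : nat) :
  (forall i, closed (C i)) -> (forall i, P `<=` closure (P `\` C i)) ->
  closed (\big[setU/set0]_(i < n) C i) /\
  P `<=` closure (P `\` \big[setU/set0]_(i < n) C i).
Proof.
move=> cC dC; elim: n => [|n [cN dN]].
  rewrite big_ord0 setD0; split; [exact: closed0|exact: subset_closure].
rewrite big_ord_recr /=; split; first exact: closedU.
exact: closure_codenseU.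
Qed.

Lemma perfect_codense1 {T : topologicalType} (P : set T) (a : T) :
  perfect_set P -> P `<=` closure (P `\ a).
Proof.
move=> [_ lP] x Px V nV; have [xa|xa] := pselect (x = a).
  have : limit_point P x by rewrite lP.
  move=> /(_ V nV)[y [yx Py Vy]]; exists y; split=> //; split=> //= ya.
  by case/eqP: yx; rewrite xa.
by exists x; split; last exact: nbhs_singleton.
Qed.

(** The union of open sets [V a], each meeting [A] only in [a], may contain points outside [A].
    Intersecting with the closure of [isolated A] removes them: near such a point, [V a] minus [a]
    would contain another point of [A]. *)
Lemma isolated_Gdelta {T : topologicalType} (A : set T) :
  accessible_space T -> (forall C : set T, closed C -> Gdelta C) ->
  Gdelta (isolated A).
Proof.
move=> T1 clG.
have /choice[V VP] : forall a, exists V : set T,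
    isolated A a -> open V /\ V `&` A = [set a].
  move=> a; have [[Aa [V nV VA]]|niA] := pselect (isolated A a); last by exists setT.
  exists V°; move=> _; split; first exact: open_interior.
  apply/seteqP; split=> [y [Vy Ay]|_ ->].
    by rewrite -VA; split=> //; exact: interior_subset.
  by split; [exact: nV|exact: set_mem].
suff -> : isolated A = closure (isolated A) `&` \bigcup_(a in isolated A) V a.
  apply: GdeltaI; first exact/clG/closed_closure.
  by apply/open_Gdelta/bigcup_open => a /VP[].
apply/seteqP; split=> [x ix|x [cx [a ia Vx]]].
  split; first exact: subset_closure.
  exists x => //; have [_ VA] := VP x ix.
  by have : [set x] x by []; rewrite -VA => -[].
have [oV VA] := VP a ia.
have [->//|xa] := pselect (x = a).
have [y [iy [Vy ya]]] : isolated A `&` (V a `&` ~` [set a]) !=set0.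
  apply: cx; apply: open_nbhs_nbhs; split=> //.
  by apply: openI => //; rewrite openC; exact: accessible_closed_set1.
case: ya; have : (V a `&` A) y by split=> //; exact: isolatedS iy.
by rewrite VA.
Qed.

(** Letting [Q] depend on [k] makes later points avoid more and more closed sets; a constant [Q]
    yields a countable dense subset. *)
Lemma dense_selection {T : ptopologicalType} (U : nat -> set T) (P : set T)
    (Q : nat -> set T) :
  (forall x V, nbhs x V -> exists2 k, U k x & U k `<=` V) ->
  (forall k, U k `&` P !=set0 -> U k `&` Q k !=set0) ->
  exists (a : nat -> T) (D : set nat),
    (forall k, D k -> Q k (a k)) /\ P `<=` closure (a @` D).
Proof.
move=> Ub PQ.
have /choice[a aP] : forall k, exists a, U k `&` P !=set0 -> (U k `&` Q k) a.
  move=> k; have [/PQ[a ?]|] := pselect (U k `&` P !=set0); first by exists a.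
  by exists point.
exists a, [set k | U k `&` P !=set0]; split=> [k /aP[]//|x Px V nV].
have [k Ukx UV] := Ub x V nV.
have UP : U k `&` P !=set0 by exists x.
exists (a k); split; first by exists k.
by apply: UV; have [] := aP k UP.
Qed.

(** * Topology of the Cantor space *)

Lemma cantor_accessible : accessible_space cantor_space.
Proof. exact/hausdorff_accessible/cantor_space_hausdorff. Qed.

Lemma cantor_clopen_basis : exists U : nat -> set cantor_space,
  (forall k, clopen (U k)) /\
  forall x V, nbhs x V -> exists2 k, U k x & U k `<=` V.
Proof.
(* [clopen_surj] enumerates the clopen sets of a compact pseudometric space over the reals, so the
   Cantor space is repackaged with its pseudometric. *)
pose R : realType := Rdefinitions.R.
pose T : pseudoPMetricType R := HB.pack_for (pseudoPMetricType R) cantor_space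
  (PseudoMetric.on cantor_space).
have [h] := @clopen_surj R T cantor_space_compact.
exists h; split=> [k|x V nV]; first exact: (@funS _ _ _ _ h k).
have [W [Wx cW] WV] := zero_dimensional_cvg cantor_space_hausdorff
  cantor_zero_dimensional cantor_space_compact nV.
have [k _ hk] := @surj _ _ _ _ h W cW.
by exists k; rewrite hk.
Qed.

Lemma cantor_open_Fsigma (O : set cantor_space) : open O -> Fsigma O.
Proof.
have [U [cU Ub]] := cantor_clopen_basis.
by apply: open_Fsigma Ub => k; have [] := cU k.
Qed.

Lemma cantor_closed_Gdelta (C : set cantor_space) : closed C -> Gdelta C.
Proof.
by move=> cC; rewrite -[C]setCK GdeltaC; apply: cantor_open_Fsigma; rewrite openC.
Qed.

(** * The implications between the four conditions *)

Lemma perfectly_meager_dense_Gdelta (X A : set cantor_space) :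
  perfectly_meager X -> countable A -> dense_in_itself A ->
  exists B : set cantor_space,
    [/\ B `<=` A, closure A = closure B & Gdelta_in (X `|` A) B].
Proof.
move=> mX cA dA.
have clA : closed (closure A) by exact: closed_closure.
have /(meager_inP _ _ clA)[C [cC dC XC]] := mX _ (closure_dense_in_itself A dA).
have [U [cU Ub]] := cantor_clopen_basis.
pose N k := \big[setU/set0]_(i < k) C i.
have [b [D [bD AD]]] : exists (b : nat -> cantor_space) (D : set nat),
    (forall k, D k -> (A `\` N k) (b k)) /\ A `<=` closure (b @` D).
  apply: (dense_selection U A (fun k => A `\` N k) Ub) => k [x [Ukx Ax]].
  have [cN dN] := closed_bigsetU_codense (closure A) C k cC dC.
  have oU : open (U k) by have [] := cU k.
  have [y [[Ay nNy] Uy]] : (closure A `\` N k) `&` U k !=set0.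
    by apply: (dN x (subset_closure Ax)); exact: open_nbhs_nbhs.
  (* The point [y] is only in the closure of [A]; as [N k] is closed, it can be moved into [A]
     without leaving [U k] or entering [N k]. *)
  have [z [Az [Uz nNz]]] : A `&` (U k `&` ~` N k) !=set0.
    apply: Ay; apply: open_nbhs_nbhs; split=> //.
    by apply: openI => //; rewrite openC.
  by exists z.
have BA : b @` D `<=` A by move=> _ [k /bD[Abk _] <-].
exists (b @` D); split=> //.
  apply/seteqP; split; last exact: closureS.
  by rewrite closureE; apply: smallest_sub => //; exact: closed_closure.
apply/Gdelta_inP.
(* [H] is an F-sigma set that is to contain exactly the points of [X] and [A] outside the selected
   set. Removing from [C i] the finitely many [b k] with [k <= i] suffices, because [b k] avoids
   [C i] once [i < k]. *)
pose H := ~` closure A `|` (A `\` b @` D)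
  `|` \bigcup_i (C i `\` b @` (D `&` `I_i.+1)).
exists (~` H).
  apply/GdeltaC/FsigmaU; first apply: FsigmaU.
  - by apply: cantor_open_Fsigma; rewrite openC.
  - apply: countable_Fsigma cantor_accessible _.
    exact: sub_countable (subset_card_le (@subDsetl _ _ _)) cA.
  - apply: Fsigma_bigcup => // i _; apply: FsigmaI; first exact: closed_Fsigma.
    apply: cantor_open_Fsigma; rewrite openC.
    apply: (accessible_finite_set_closed.1 cantor_accessible).
    exact/finite_image/finite_setIr/finite_II.
apply/seteqP; split=> [x Bx|x [nHx XAx]].
  split; last by right; exact: BA.
  case=> [[|[_]]|]; [|by []|].
    by apply; apply: subset_closure; exact: BA.
  case=> i _ [Cx]; apply.
  case: Bx Cx => k Dk <- Cx; exists k => //; split=> //=.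
  rewrite ltnNge; apply/negP => ik.
  have [_ []] := bD k Dk; rewrite /N -bigcup_mkord.
  by exists i.
apply: contrapT => nBx; apply: nHx.
have [Ax|nAx] := pselect (A x); first by left; right.
have [clx|nclx] := pselect (closure A x); last by left; left.
have [i _ Cx] : (\bigcup_i C i) x by apply: XC; split=> //; case: XAx.
right; exists i => //; split=> // -[k [Dk _] bk]; apply: nBx.
by exists k.
Qed.

Lemma Gdelta_dense_meager_cover (X P : set cantor_space) :
  (forall A : set cantor_space, countable A ->
     exists B : set cantor_space,
       [/\ B `<=` A, closure A = closure B & Gdelta_in (X `|` A) B]) ->
  perfect_set P ->
  exists F : set cantor_space, [/\ Fsigma F, X `<=` F & meager_in P F].
Proof.
move=> XG /[dup] pP [cP _].
have [U [cU Ub]] := cantor_clopen_basis.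
have [a [D [aD PD]]] : exists (a : nat -> cantor_space) (D : set nat),
    (forall k, D k -> P (a k)) /\ P `<=` closure (a @` D).
  exact: (dense_selection U P (fun=> P) Ub).
have AP : a @` D `<=` P by move=> _ [k /aD ? <-].
have cA : countable (a @` D) by apply: sub_countable (card_image_le _ _) _.
have [B [BA clAB /Gdelta_inP[_ [G oG ->] BG]]] := XG _ cA.
(* One sequence of closed sets witnesses both F-sigma and meager. Adding [a i] also for [i] outside
   [D] is harmless, since every singleton has dense complement in [P]. *)
exists (\bigcup_i (~` G i `|` [set a i])); split.
- exists (fun i => ~` G i `|` [set a i]) => // i; apply: closedU.
    by rewrite closedC.
  exact: accessible_closed_set1 cantor_accessible _.
- move=> x Xx; have [Gx|] := pselect ((\bigcap_i G i) x).
    have /BA[k _ <-] : B x by rewrite BG; split=> //; left.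
    by exists k => //; right.
  by move/existsNP => [i /not_implyP[_ nGx]]; exists i => //; left.
- apply/(meager_inP _ _ cP); exists (fun i => ~` G i `|` [set a i]); split.
  + move=> i; apply: closedU; first by rewrite closedC.
    exact: accessible_closed_set1 cantor_accessible _.
  + move=> i; apply: closure_codenseU; first by rewrite closedC.
      (* The complement of [~] G i[is dense in]P[because it contains]B[, which has the same closure
         as the dense set]a @[D]. *)
      apply: subset_trans PD _; rewrite clAB; apply: closureS => x Bx.
      split; first exact/AP/BA.
      by apply; move: Bx; rewrite BG => -[Gx _]; exact: Gx.
    exact: perfect_codense1.
  + exact: subIsetl.
Qed.

Lemma dense_in_itself_countable_Gdelta (X : set cantor_space) :
  (forall A : set cantor_space, countable A -> dense_in_itself A ->
     exists B : set cantor_space,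
       [/\ B `<=` A, closure A = closure B & Gdelta_in (X `|` A) B]) ->
  forall A : set cantor_space, countable A ->
    exists B : set cantor_space,
      [/\ B `<=` A, closure A = closure B & Gdelta_in (X `|` A) B].
Proof.
move=> XG A cA.
pose K := \bigcup_(E in [set E : set cantor_space | E `<=` A /\ dense_in_itself E]) E.
have sub_kernel (E : set cantor_space) : E `<=` A -> dense_in_itself E -> E `<=` K.
  by move=> EA dE x Ex; exists E.
have KA : K `<=` A by move=> x [E [EA _] /EA].
have dK : dense_in_itself K.
  rewrite /dense_in_itself -subset0 => x [/set_mem Kx [V nV VK]].
  have [E [EA dE] Ex] := Kx.
  rewrite -dE; split; first exact/mem_set.
  exists V => //; apply/seteqP; split=> [y [Vy Ey]|_ ->]; last first.
    by split=> //; exact: nbhs_singleton.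
  by rewrite -VK; split=> //; exists E.
(* Points of [A] in the closure of [K] form a dense-in-itself set again, so maximality makes [K]
   closed relative to [A]. *)
have clKA : A `&` closure K `<=` K.
  apply: sub_kernel; first exact: subIsetl.
  rewrite /dense_in_itself -subset0 -dK; apply: isolated_sandwich.
    by move=> x Kx; split; [exact: KA|exact: subset_closure].
  exact: subIsetr.
have cK : countable K by exact: sub_countable (subset_card_le KA) cA.
have [B [BK clB /Gdelta_inP[G GG BG]]] := XG K cK dK.
exists (isolated A `|` B); split.
- by move=> x [/isolatedS//|/BK/KA].
- apply/seteqP; split; last first.
    by apply: closureS => x [/isolatedS//|/BK/KA].
  rewrite closureE; apply: smallest_sub; first exact: closed_closure.
  move=> x Ax W; rewrite nbhsE => -[V [oV Vx] VW].
  (* Either [V] contains an isolated point of [A], or [V] and [A] meet in a dense-in-itself set;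
     then [x] lies in [K], where [B] is dense. *)
  have [[y]|nV] := pselect (isolated (V `&` A) !=set0).
    move=> /(isolated_setI _ _ oV)[Vy iy].
    by exists y; split; [left|exact: VW].
  have Kx : K x.
    apply: (sub_kernel (V `&` A)); [exact: subIsetr| |by []].
    by rewrite /dense_in_itself -subset0 => y iy; apply: nV; exists y.
  have : closure B x by rewrite -clB; exact: subset_closure.
  move=> /(_ V (open_nbhs_nbhs (conj oV Vx)))[y [By Vy]].
  by exists y; split; [right|exact: VW].
(* [G] cuts out [B] only from [X] and [K]; by [clKA], the factor [closure K] excludes the points of
   [A] outside [K]. *)
- apply/Gdelta_inP; exists (isolated A `|` (G `&` closure K)).
    apply: GdeltaU.
      exact: isolated_Gdelta cantor_accessible cantor_closed_Gdelta.
    by apply: GdeltaI => //; exact/cantor_closed_Gdelta/closed_closure.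
  apply/seteqP; split=> x.
    case=> [ix|Bx].
      by split; [left|right; exact: isolatedS].
    move: (Bx); rewrite BG => -[Gx XKx]; split.
      by right; split=> //; exact/subset_closure/BK.
    by case: XKx => [?|/KA ?]; [left|right].
  case=> -[ix _|[Gx clx] XAx]; first by left.
  right; rewrite BG; split=> //.
  by case: XAx => [?|Ax]; [left|right; exact: clKA].
Qed.

Theorem theorem6 (X : set cantor_space) :
  [<->
    (* (1) *)
    perfectly_meager X;
    (* (2) *)
    forall A : set cantor_space, countable A -> dense_in_itself A ->
      exists B : set cantor_space,
        [/\ B `<=` A, closure A = closure B & Gdelta_in (X `|` A) B];
    (* (3) *)
    forall A : set cantor_space, countable A ->
      exists B : set cantor_space,
        [/\ B `<=` A, closure A = closure B & Gdelta_in (X `|` A) B];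
    (* (4) *)
    forall P : set cantor_space, perfect_set P ->
      exists F : set cantor_space,
        [/\ Fsigma F, X `<=` F & meager_in P F]].
Proof.
split=> [mX A|]; first exact: perfectly_meager_dense_Gdelta.
split; first exact: dense_in_itself_countable_Gdelta.
split=> [XG P|XF P pP]; first exact: Gdelta_dense_meager_cover.
(* For (4) => (1), the closed sets covering [F] within [P] also cover [X] within [P]. *)
have [cP _] := pP; have [F [_ XF' /(meager_inP _ _ cP)[C [cC dC FC]]]] := XF P pP.
apply/(meager_inP _ _ cP); exists C; split=> //.
by apply: subset_trans FC; exact: setSI.
Qed.
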